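(* Let $k\ge2$. For any $\varphi,\psi\in M_{k,1}$: $$\psi\le_{\mathcal L}\varphi\quad\text{iff}\quad{\sf part}(\psi)\le_{\sf end}{\sf part}(\varphi).$$
   Context: $A=\{a_1,\dots,a_k\}$ is an alphabet with $k\ge2$ letters, $A^*$ the free monoid over $A$. A right ideal of $A^*$ is a set $R\subseteq A^*$ with $RA^*\subseteq R$. A prefix code is a set of words none of which is a prefix of another; every right ideal is $PA^*$ for a unique prefix code $P$, and is finitely generated iff $P$ is finite. A right ideal homomorphism is a function $\varphi$ whose domain ${\sf Dom}(\varphi)\subseteq A^*$ is a right ideal, with values in $A^*$ and $\varphi(xw)=\varphi(x)w$ for all $x\in{\sf Dom}(\varphi)$, $w\in A^*$; ${\sf domC}(\varphi)$ is the prefix code generating ${\sf Dom}(\varphi)$. ${\sf riHom}(A^* )$ is the set of right ideal homomorphisms with finitely generated domain. A right ideal $R'\subseteq R$ is essential in the right ideal $R$ iff $R'$ intersects every nonempty right ideal contained in $R$. $\Phi$ is an essentially equal restriction of $\varphi$ iff $\Phi$ is a restriction of $\varphi$ and ${\sf Dom}(\Phi)$ is essential in ${\sf Dom}(\varphi)$; then $\varphi$ is an essentially equal extension of $\Phi$. Every $\varphi\in{\sf riHom}(A^* )$ has a unique maximal essentially equal extension $\max(\varphi)$. The Thompson-Higman monoid is $M_{k,1}=\{\max(\varphi):\varphi\in{\sf riHom}(A^* )\}$ with multiplication $\psi\varphi=\max(\psi\circ\varphi)$ (functions act on the left); $\varphi$ represents the element $\max(\varphi)$. $\psi\le_{\mathcal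 L}\varphi$ means $\psi=\alpha\varphi$ for some $\alpha\in M_{k,1}$. Two finitely generated right ideals $R_1,R_2$ are essentially equal, $R_1=_{\sf ess}R_2$, iff they have the same ends, i.e. the same infinite words in $A^\omega$ have a prefix in $R_1$ as in $R_2$. A right congruence on a right ideal $R$ is an equivalence relation $\simeq$ on $R$ such that $x\simeq y$ implies $xw\simeq yw$ for all $w\in A^*$; its domain is ${\sf Dom}(\simeq)=R$. A prefix code congruence is a right congruence $\simeq$ on $PA^*$, with $P$ a finite prefix code, that is generated by its restriction to $P$: i.e. the $\simeq$-classes are exactly the sets $P_jw$ ($w\in A^*$, $1\le j\le n$), where $\{P_1,\dots,P_n\}$ is a partition of $P$. One writes ${\sf domC}(\simeq)=P$. A prefix code congruence $\simeq'$ is an essentially equal restriction of a prefix code congruence $\simeq$ iff ${\sf Dom}(\simeq')=_{\sf ess}{\sf Dom}(\simeq)$, ${\sf Dom}(\simeq')\subseteq{\sf Dom}(\simeq)$, and for all $x,y\in{\sf Dom}(\simeq')$: $x\simeq' y\Leftrightarrow x\simeq y$. For prefix code congruences, $\simeq_2\ \le_{\sf end}\ \simeq_1$ (''$\simeq_1$ is an end refinement of $\simeq_2$'') means: there are prefix code congruences $\simeq_1',\simeq_2'$ such that $\simeq_i'$ is an essentially equal restriction of $\simeq_i$ ($i=1,2$), ${\sf domC}(\simeq_2')\subseteq{\sf domC}(\simeq_1')$, and every class of $\simeq_2'$ is a union of classes of $\simeq_1'$. For $\varphi\in{\sf riHom}(A^* )$, ${\sf part}(\varphi)$ is the right congruence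 on ${\sf Dom}(\varphi)$ given by $x_1\equiv x_2$ iff $\varphi(x_1)=\varphi(x_2)$. Every element of $M_{k,1}$ can be represented by some $\varphi\in{\sf riHom}(A^* )$ such that $\varphi({\sf domC}(\varphi))$ is a prefix code, equivalently such that ${\sf part}(\varphi)$ is a prefix code congruence. When ${\sf part}(\varphi)$ is used, $\varphi$ is always assumed to be given by such a representative. *)

(* Defs.v *)
From mathcomp Require Import all_boot.
From mathcomp Require Import all_classical.

Set Implicit Arguments.
Unset Strict Implicit.
Unset Printing Implicit Defensive.

Local Open Scope classical_set_scope.

Definition right_ideal (A : finType) (R : set (seq A)) : Prop :=
  forall x w, R x -> R (x ++ w).

Definition prefix_code (A : finType) (P : set (seq A)) : Prop :=
  forall x y, P x -> P y -> prefix x y -> x = y.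

(* P A^* *)
Definition ideal_gen (A : finType) (P : set (seq A)) : set (seq A) :=
  [set p ++ w | p in P & w in [set: seq A]].

Definition finitely_generated (A : finType) (R : set (seq A)) : Prop :=
  exists2 P : set (seq A), finite_set P & R = ideal_gen P.

(* The prefix code generating a right ideal; see [gen_codeP]. *)
Definition gen_code (A : finType) (R : set (seq A)) : set (seq A) :=
  [set x | R x /\ forall y, R y -> prefix y x -> y = x].

Definition essential (A : finType) (R' R : set (seq A)) : Prop :=
  R' `<=` R /\
  forall I : set (seq A), right_ideal I -> I !=set0 -> I `<=` R ->
    (I `&` R') !=set0.

(* Infinite words are functions [nat -> A]; [mkseq u n] is the prefix of
   length [n] of [u]. *)
Definition ends (A : finType) (R : set (seq A)) : set (nat -> A) :=
  [set u | exists n, R (mkseq u n)].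

Definition ess_eq (A : finType) (R1 R2 : set (seq A)) : Prop :=
  ends R1 = ends R2.

Definition pdom (A : finType) (f : seq A -> option (seq A)) : set (seq A) :=
  [set x | f x].

Record riHom (A : finType) := RiHom {
  rifun :> seq A -> option (seq A);
  rifun_ideal : right_ideal (pdom rifun);
  rifun_hom : forall x y w, rifun x = Some y -> rifun (x ++ w) = Some (y ++ w);
  rifun_fg : finitely_generated (pdom rifun)
}.

Definition Dom (A : finType) (phi : riHom A) : set (seq A) := pdom phi.

Definition domC (A : finType) (phi : riHom A) : set (seq A) :=
  gen_code (Dom phi).

Definition pimage (A : finType) (phi : riHom A) (X : set (seq A)) :
  set (seq A) := [set y | exists2 x, X x & phi x = Some y].

Definition restriction (A : finType) (Phi phi : riHom A) : Prop :=
  forall x y, Phi x = Some y -> phi x = Some y.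

Definition ess_restriction (A : finType) (Phi phi : riHom A) : Prop :=
  restriction Phi phi /\ essential (Dom Phi) (Dom phi).

Definition is_max_ext (A : finType) (phi Phi : riHom A) : Prop :=
  ess_restriction phi Phi /\
  forall Psi : riHom A,
    ess_restriction phi Psi -> restriction Phi Psi -> Psi = Phi.

(* An equivalence relation on a subset [R] of [A^*] is encoded as a partial
   equivalence relation on [A^*] whose domain is [R]. *)
Definition cdom (A : finType) (sim : seq A -> seq A -> Prop) : set (seq A) :=
  [set x | sim x x].

Definition right_congruence (A : finType) (sim : seq A -> seq A -> Prop) :
  Prop :=
  [/\ forall x y, sim x y -> sim y x,
      forall x y z, sim x y -> sim y z -> sim x z &
      forall x y w, sim x y -> sim (x ++ w) (y ++ w)].

Definition is_class (A : finType) (sim : seq A -> seq A -> Prop)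
  (C : set (seq A)) : Prop :=
  exists2 x, cdom sim x & C = [set y | sim x y].

Definition cdomC (A : finType) (sim : seq A -> seq A -> Prop) :
  set (seq A) := gen_code (cdom sim).

Definition prefix_code_congruence (A : finType)
  (sim : seq A -> seq A -> Prop) : Prop :=
  right_congruence sim /\
  exists P : set (seq A),
    [/\ finite_set P, prefix_code P, cdom sim = ideal_gen P &
        exists (n : nat) (Pj : 'I_n -> set (seq A)),
          partition [set: 'I_n] Pj P /\
          forall C : set (seq A),
            is_class sim C <->
            exists (j : 'I_n) (w : seq A), C = [set p ++ w | p in Pj j]].

Definition cong_ess_restriction (A : finType)
  (sim' sim : seq A -> seq A -> Prop) : Prop :=
  [/\ ess_eq (cdom sim') (cdom sim), cdom sim' `<=` cdom sim &
      forall x y, cdom sim' x -> cdom sim' y -> (sim' x y <-> sim x y)].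

(* [le_end sim2 sim1] : [sim1] is an end refinement of [sim2]. *)
Definition le_end (A : finType) (sim2 sim1 : seq A -> seq A -> Prop) : Prop :=
  exists sim1' sim2' : seq A -> seq A -> Prop,
    [/\ prefix_code_congruence sim1' /\ cong_ess_restriction sim1' sim1,
        prefix_code_congruence sim2' /\ cong_ess_restriction sim2' sim2,
        cdomC sim2' `<=` cdomC sim1' &
        forall C, is_class sim2' C ->
          exists2 F : set (set (seq A)),
            (forall D, F D -> is_class sim1' D) & C = \bigcup_(D in F) D].

Definition part (A : finType) (phi : riHom A) (x1 x2 : seq A) : Prop :=
  [/\ Dom phi x1, Dom phi x2 & phi x1 = phi x2].

Lemma gen_codeP (A : finType) (R P : set (seq A)) :
  right_ideal R ->
  (prefix_code P /\ R = ideal_gen P) <-> P = gen_code R.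
Proof.
move=> idR; split=> [[pcP RE]|->].
  apply/seteqP; split=> x /=.
    move=> Px; split; first by rewrite RE; exists x => //; exists [::] => //; rewrite cats0.
    move=> y; rewrite RE => -[p Pp [w _ <-]] /prefixP[v xE].
    have pE : p = x by apply: pcP => //; rewrite xE -catA; exact: prefix_prefix.
    move: xE; rewrite pE => /(congr1 size); rewrite !size_cat => sE.
    suff -> : w = [::] by rewrite cats0.
    by apply/nilP; rewrite /nilp -leqn0 -(leq_add2l (size x)) addn0 {2}sE leq_addr.
  move=> [Rx minx]; move: (Rx); rewrite RE => -[p Pp [w _ xE]].
  rewrite -(minx p) //.
    by rewrite RE; exists p => //; exists [::] => //; rewrite cats0.
  by rewrite -xE; exact: prefix_prefix.
split=> [x y [Rx minx] [Ry miny] xy|]; first exact: miny.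
apply/seteqP; split=> [x Rx|_ [p [Rp _] [w _ <-]]]; last exact: idR.
have exn : exists n, `[< R (take n x) >] by exists (size x); rewrite take_size; apply/asboolP.
case: (ex_minnP exn) => n /asboolP Rn minn.
exists (take n x); last by exists (drop n x) => //; rewrite cat_take_drop.
split=> // y Ry /prefixP[v vE].
have yE : y = take (size y) x.
  by rewrite -(cat_take_drop n x) vE -catA take_size_cat.
have ny : n <= size y by apply: minn; apply/asboolP; rewrite -yE.
have sy : size y + size v <= n by rewrite -size_cat -vE size_take_min geq_minl.
have v0 : v = [::].
  by apply/nilP; rewrite /nilp -leqn0 -(leq_add2l (size y)) addn0 (leq_trans sy).
by rewrite vE v0 cats0.
Qed.

Lemma pdom_ideal (A : finType) (f : seq A -> option (seq A)) :
  (forall x y w, f x = Some y -> f (x ++ w) = Some (y ++ w)) ->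
  right_ideal (pdom f).
Proof. by move=> fh x w; rewrite /pdom /=; case E: (f x) => [y|//] _; rewrite (fh _ _ _ E). Qed.

Lemma fg_prefixes (A : finType) (R : set (seq A)) (n : nat) :
  right_ideal R -> (forall x, gen_code R x -> size x <= n) ->
  finitely_generated R.
Proof.
move=> idR bR; exists (gen_code R); last first.
  by case/(gen_codeP _ idR): (erefl (gen_code R)).
suff fin : finite_set [set x : seq A | size x <= n].
  by apply: sub_finite_set fin.
have -> : [set x : seq A | size x <= n] =
   (fun t : (n.-tuple (option A)) => pmap id t) @` [set: n.-tuple (option A)].
  apply/seteqP; split=> [x /= xn|_ [t _ <-] /=]; last first.
    by rewrite size_pmap -[X in _ <= X](size_tuple t) count_size.
  have sz : size (map Some x ++ nseq (n - size x) None) == n.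
    by rewrite size_cat size_map size_nseq subnKC.
  exists (Tuple sz) => //=; rewrite pmap_cat map_pK //.
  have -> : pmap id (nseq (n - size x) (@None A)) = [::] by elim: (n - _).
  by rewrite cats0.
exact/finite_image/finite_finset.
Qed.

Lemma fg_bound (A : finType) (R : set (seq A)) :
  finitely_generated R ->
  exists2 P : set (seq A), R = ideal_gen P &
     exists n, forall p, P p -> size p <= n.
Proof.
move=> [P /finite_seqP[s sE] RE]; exists P => //.
exists (\max_(p <- s) size p) => p; rewrite sE /= => ps.
exact: (@leq_bigmax_seq _ s xpredT size).
Qed.

Lemma comp_hom (A : finType) (psi phi : riHom A) x y w :
  obind psi (phi x) = Some y -> obind psi (phi (x ++ w)) = Some (y ++ w).
Proof.
by case E: (phi x) => [z|//] /= /rifun_hom h; rewrite (rifun_hom _ E) /= h.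
Qed.

Lemma comp_fg (A : finType) (psi phi : riHom A) :
  finitely_generated (pdom (fun x => obind psi (phi x))).
Proof.
have [P PE [n bP]] := fg_bound (rifun_fg phi).
have [Q QE [m bQ]] := fg_bound (rifun_fg psi).
apply: (@fg_prefixes _ _ (n + m)); first exact/pdom_ideal/comp_hom.
move=> x [xD minx].
have : pdom phi x by move: xD; rewrite /pdom /=; case: (phi x).
rewrite PE => -[p Pp [w _ xE]].
have : pdom phi p by rewrite PE; exists p => //; exists [::] => //; rewrite cats0.
rewrite /pdom /=; case pz: (phi p) => [z|//] _.
have xz : phi x = Some (z ++ w) by rewrite -xE (rifun_hom _ pz).
have : pdom psi (z ++ w) by move: xD; rewrite /pdom /= xz.
rewrite QE => -[q Qq [v _ qE]].
case: (leqP (size w) m) => [wm|/ltnW wm].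
  by rewrite -xE size_cat leq_add // bP.
suff : p ++ take m w = x.
  by move=> <-; rewrite size_cat leq_add ?bP // size_take_min geq_minl.
apply: minx; last by rewrite -xE -{2}(cat_take_drop m w) catA prefix_prefix.
rewrite /pdom /= (rifun_hom _ pz) /=.
suff : pdom psi (z ++ take m w) by [].
rewrite QE; exists q => //.
have : prefix q (z ++ w) by rewrite -qE prefix_prefix.
rewrite -{1}(cat_take_drop m w) catA.
rewrite prefixE take_cat size_cat size_takel //.
case: ltnP => [_ /eqP qE'|qm _].
  exists (drop (size q) (z ++ take m w)) => //.
  by rewrite -{1}qE' cat_take_drop.
have qm' : size q <= size z + m by rewrite (leq_trans (bQ _ Qq)) // leq_addl.
exists [::] => //; rewrite cats0.
have := qE => /(congr1 (take (size q))); rewrite take_size_cat // => ->.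
have -> : size q = size z + m by apply/eqP; rewrite eqn_leq qm' qm.
by rewrite takeD take_size_cat // drop_size_cat.
Qed.

Definition comp (A : finType) (psi phi : riHom A) : riHom A :=
  @RiHom A (fun x => obind psi (phi x))
    (pdom_ideal (@comp_hom A psi phi)) (@comp_hom A psi phi)
    (@comp_fg A psi phi).

Lemma riHom_ext (A : finType) (phi psi : riHom A) :
  (forall x, phi x = psi x) -> phi = psi.
Proof.
case: phi => f f1 f2 f3; case: psi => g g1 g2 g3 /= /funext fg.
by subst g; congr RiHom; exact: Prop_irrelevance.
Qed.

Lemma catIs_inj (T : eqType) (x y w : seq T) : x ++ w = y ++ w -> x = y.
Proof.
move=> e; have s : size x = size y.
  by move/(congr1 size): e; rewrite !size_cat => /addIn.
by move/eqP: e; rewrite eqseq_cat // => /andP[/eqP].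
Qed.

Lemma ess_ext_agree (A : finType) (phi f g : riHom A) x y z :
  ess_restriction phi f -> ess_restriction phi g ->
  f x = Some y -> g x = Some z -> y = z.
Proof.
move=> [pf [_ ef]] [pg _] fx gx.
have [] := ef (ideal_gen [set x]).
- by move=> _ w [p -> [v _ <-]]; exists x => //; exists (v ++ w); rewrite ?catA.
- by exists x; exists x => //; exists [::]; rewrite ?cats0.
- move=> _ [p -> [v _ <-]]; apply: rifun_ideal.
  by rewrite /pdom /= fx.
- move=> _ [[_ -> [w _ <-]]]; rewrite /Dom /pdom /=.
  case E: (phi (x ++ w)) => [u|//] _.
  move: (pf _ _ E) (pg _ _ E); rewrite (rifun_hom _ fx) (rifun_hom _ gx).
  by move=> [yu] [zu]; apply: (@catIs_inj _ _ _ w); rewrite yu zu.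
Qed.

Lemma max_ext_exists (A : finType) (phi : riHom A) :
  exists! Phi : riHom A, is_max_ext phi Phi.
Proof.
pose S x y := exists2 f : riHom A, ess_restriction phi f & f x = Some y.
have SU x y z : S x y -> S x z -> y = z.
  by move=> [f ef fx] [g eg gx]; exact: (ess_ext_agree ef eg fx gx).
pose F x := if pselect (exists y, S x y) is left e then Some (projT1 (cid e)) else None.
have FP x y : F x = Some y <-> S x y.
  rewrite /F; case: pselect => [e|ne]; last first.
    by split=> // s; case: ne; exists y.
  by case: cid => z /= Sz; split=> [[<-//]|Sy]; congr Some; exact: SU Sz Sy.
have Fh x y w : F x = Some y -> F (x ++ w) = Some (y ++ w).
  by move/FP => -[f ef fx]; apply/FP; exists f => //; exact: rifun_hom.
have phiS : ess_restriction phi phi.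
  by split=> //; split=> // I _ [x Ix] ID; exists x; split=> //; exact: ID.
have essF : essential (Dom phi) (pdom F).
  split=> [x|I idI [x Ix] IF].
    rewrite /Dom /pdom /=; case E: (phi x) => [y|//] _.
    by have -> : F x = Some y by apply/FP; exists phi.
  have : pdom F x by exact: IF.
  rewrite /pdom /=; case E: (F x) => [y|//] _.
  move/FP: E => [f [_ [_ ef]] fx].
  have [] := ef (ideal_gen [set x]).
  - by move=> _ w [p -> [v _ <-]]; exists x => //; exists (v ++ w); rewrite ?catA.
  - by exists x; exists x => //; exists [::]; rewrite ?cats0.
  - move=> _ [p -> [v _ <-]]; apply: rifun_ideal.
    by rewrite /pdom /= fx.
  - move=> z [[_ -> [w _ <-]] zD]; exists (x ++ w); split=> //; exact: idI.
have Ffg : finitely_generated (pdom F).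
  have [P PE [n bP]] := fg_bound (rifun_fg phi).
  apply: (@fg_prefixes _ _ n); first exact: pdom_ideal.
  move=> x [xF minx]; have [] := essF.2 (ideal_gen [set x]).
  - by move=> _ w [p -> [v _ <-]]; exists x => //; exists (v ++ w); rewrite ?catA.
  - by exists x; exists x => //; exists [::]; rewrite ?cats0.
  - by move=> _ [p -> [v _ <-]]; apply: pdom_ideal.
  move=> _ [[_ -> [w _ <-]]]; rewrite /Dom PE => -[p Pp [v _ pv]].
  case: (leqP (size x) n) => // nx.
  have px : prefix p x.
    rewrite prefixE; have := congr1 (take (size p)) pv.
    rewrite take_size_cat // take_cat (leq_ltn_trans (bP _ Pp) nx) => <-; exact/eqP.
  move: nx; rewrite ltnNge -(minx p) ?bP //; apply: essF.1.
  by rewrite /Dom PE; exists p => //; exists [::]; rewrite ?cats0.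
pose G := RiHom (pdom_ideal Fh) Fh Ffg.
have eG : ess_restriction phi G by split=> [x y E|//]; apply/FP; exists phi.
have gG f : ess_restriction phi f -> restriction f G.
  by move=> ef x y fx; apply/FP; exists f.
have anti (f g : riHom A) : restriction f g -> restriction g f -> f = g.
  move=> fg gf; apply: riHom_ext => x.
  case E: (f x) => [y|]; first by rewrite (fg _ _ E).
  by case E': (g x) => [y|//]; rewrite (gf _ _ E') in E.
exists G; split; first by split=> // f ef Gf; apply: anti => //; exact: gG.
by move=> f [ef mf]; apply: mf => //; exact: gG.
Qed.

Definition max_ext (A : finType) (phi : riHom A) : riHom A :=
  projT1 (cid (max_ext_exists phi)).

Lemma max_extP (A : finType) (phi Phi : riHom A) :
  is_max_ext phi Phi <-> max_ext phi = Phi.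
Proof.
rewrite /max_ext; case: cid => G /= [mG uG]; split; first exact: uG.
by move=> <-.
Qed.

Record thompson_higman (A : finType) := ThompsonHigman {
  th_val :> riHom A;
  th_valP : exists phi : riHom A, th_val = max_ext phi
}.

Definition th_class (A : finType) (phi : riHom A) : thompson_higman A :=
  ThompsonHigman (ex_intro _ phi (erefl (max_ext phi))).

Definition th_mul (A : finType) (psi phi : thompson_higman A) :
  thompson_higman A := th_class (comp psi phi).

Definition represents (A : finType) (phi : riHom A) (f : thompson_higman A) :
  Prop := th_val f = max_ext phi.

Definition le_L (A : finType) (psi phi : thompson_higman A) : Prop :=
  exists alpha : thompson_higman A, psi = th_mul alpha phi.

Lemma part_pcc (A : finType) (phi : riHom A) :
  prefix_code (pimage phi (domC phi)) -> prefix_code_congruence (part phi).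
Proof.
move=> pcI; have hc : cdom (part phi) = Dom phi.
  by apply/seteqP; split=> x; [case|].
have [pcP DE] := (gen_codeP (domC phi) (@rifun_ideal A phi)).2 erefl.
have finP : finite_set (domC phi).
  have [P fP PE] := rifun_fg phi; apply: sub_finite_set fP => x [].
  rewrite /Dom PE => -[p Pp [w _ xE]] minx; rewrite -(minx p) //.
    by exists p => //; exists [::]; rewrite ?cats0.
  by rewrite -xE prefix_prefix.
split.
  split=> [x y []|x y z [dx dy xy] [_ dz yz]|x y w [dx dy xy]] //.
    by split=> //; rewrite xy.
  split; try exact: rifun_ideal.
  move: dx; rewrite /Dom /pdom /=; case E: (phi x) => [u|//] _.
  by rewrite (rifun_hom _ E) (rifun_hom w (etrans (esym xy) E)).
exists (domC phi); split; rewrite ?hc //.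
have domCE p : domC phi p -> exists2 y, phi p = Some y &
    pimage phi (domC phi) y.
  move=> Pp; case: (Pp) => + _; rewrite /Dom /pdom /=.
  by case E: (phi p) => [y|//] _; exists y => //; exists p.
have : finite_set (pimage phi (domC phi)).
  apply: (@sub_finite_set _ _ ((fun x => odflt [::] (phi x)) @` domC phi)).
    by move=> y [x Px xy]; exists x => //; rewrite xy.
  exact: finite_image.
move=> /finite_seqP[s0 sE]; pose s := undup s0.
have sP y : pimage phi (domC phi) y <-> y \in s by rewrite mem_undup sE.
exists (size s), (fun j => [set p | domC phi p /\ phi p = Some (nth [::] s j)]).
split.
  split.
  - apply/seteqP; split=> [p [j _ []]//|p Pp].
    have [y py /sP ys] := domCE _ Pp.
    have ij : index y s < size s by rewrite index_mem.
    by exists (Ordinal ij) => //; split; rewrite //= nth_index.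
  - move=> i j _ _ [p [[_ pi] [_ pj]]]; apply/val_inj/eqP.
    move: pi; rewrite pj => -[/eqP].
    by rewrite nth_uniq ?undup_uniq // eq_sym.
  - move=> j _; have /sP[p Pp pj] : nth [::] s j \in s by rewrite mem_nth.
    by exists p.
have cls j w x : domC phi x -> phi x = Some (nth [::] s j) ->
    [set y | part phi (x ++ w) y] =
    [set p ++ w | p in [set p | domC phi p /\ phi p = Some (nth [::] s j)]].
  move=> Px xj; apply/seteqP; split=> [y [_ + e]|_ [p [Pp pj] <-]] /=.
    rewrite /Dom DE => -[q Qq [v _ qE]]; have [z qz Iz] := domCE _ Qq.
    move: e; rewrite -qE (rifun_hom _ xj) (rifun_hom _ qz) => -[e].
    have Ij : pimage phi (domC phi) (nth [::] s j) by exists x.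
    have zj : z = nth [::] s j.
      case: (leqP (size z) (size (nth [::] s j))) => [le|/ltnW le].
        have := congr1 (take (size z)) e.
        rewrite (take_size_cat v) // (takel_cat w) // => /eqP pz.
        by apply: pcI; rewrite ?prefixE.
      have := congr1 (take (size (nth [::] s j))) e.
      rewrite (take_size_cat w) // (takel_cat v) // => /esym/eqP pz.
      by apply/esym/pcI; rewrite ?prefixE.
    exists q; first by rewrite -zj.
    by move/eqP: e; rewrite zj eqseq_cat // eqxx => /eqP ->.
  split; try by apply: rifun_ideal; rewrite /pdom /= ?xj ?pj.
  by rewrite (rifun_hom _ xj) (rifun_hom _ pj).
move=> C; split=> [[x + ->]|[j [w ->]]].
  rewrite hc /Dom DE => -[p Pp [w _ <-]]; have [y py /sP ys] := domCE _ Pp.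
  have ij : index y s < size s by rewrite index_mem.
  exists (Ordinal ij), w; apply: cls => //=; by rewrite nth_index.
have /sP[p Pp pj] : nth [::] s j \in s by rewrite mem_nth.
exists (p ++ w); last by rewrite (cls j).
by rewrite hc; apply: rifun_ideal; rewrite /pdom /= pj.
Qed.

(* Main.v *)
Require Import Defs.
From mathcomp Require Import all_boot.
From mathcomp Require Import all_classical.

(** Up to essentially equal restriction, [psi = alpha phi] says that [psi]
    factors through [phi], i.e. that [phi x = phi y] implies [psi x = psi y].
    Given such a factorization, restrict [psi] to the words [x] with
    [size (psi x) >= M]; for large [M] this domain is saturated for both
    [part psi] and [part phi].  Adding to it the words with [size (phi x) >= N]
    for large [N] makes it essential in [Dom phi] without destroying
    minimality of the old generators.  Saturation keeps the images of the
    generating codes prefix codes.  Conversely, the end refinement makes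
    [phi x |-> psi x] well defined on the domain of the restricted
    congruence. *)

Set Implicit Arguments.
Unset Strict Implicit.
Unset Printing Implicit Defensive.

Local Open Scope classical_set_scope.

(** * Finitely generated right ideals, essential subideals and ends *)

Section RightIdeals.
Variable A : finType.
Implicit Types (R S : set (seq A)).

Lemma gen_code_prefix R x : right_ideal R -> R x ->
  exists p w, gen_code R p /\ x = p ++ w.
Proof.
move=> idR; have [_ RE] := (gen_codeP (gen_code R) idR).2 erefl.
by rewrite {1}RE => -[p Pp [w _ <-]]; exists p, w.
Qed.

Lemma gen_code_bounded R : finitely_generated R ->
  exists n, forall x, gen_code R x -> size x <= n.
Proof.
move=> /fg_bound[P RE [n bP]]; exists n => x [].
rewrite RE => -[p Pp [w _ xE]] minx; rewrite -(minx p) ?bP //.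
  by exists p => //; exists [::] => //; rewrite cats0.
by rewrite -xE prefix_prefix.
Qed.

(** If [n] bounds the generators, the generator that is a prefix of [x ++ w] is no longer than [x],
    so it is a prefix of [x]. *)
Lemma fg_long_prefix R : right_ideal R -> finitely_generated R ->
  exists n, forall x w, n <= size x -> R (x ++ w) -> R x.
Proof.
move=> idR /gen_code_bounded[n bn]; exists n => x w nx.
move=> /(gen_code_prefix idR)[p [v [Pp xE]]].
have -> : x = p ++ drop (size p) x.
  rewrite -{1}(cat_take_drop (size p) x); congr cat.
  have := congr1 (take (size p)) xE.
  by rewrite (take_size_cat v) // takel_cat // (leq_trans (bn _ Pp)).
exact: idR Pp.1.
Qed.

Lemma fgU R S : right_ideal R -> right_ideal S ->
  finitely_generated R -> finitely_generated S ->
  finitely_generated (R `|` S).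
Proof.
move=> idR idS /gen_code_bounded[n bn] /gen_code_bounded[m bm].
apply: (@fg_prefixes _ _ (n + m)).
  by move=> x w [/idR h|/idS h]; [left|right].
move=> x [[Rx|Sx] minx].
  apply: leq_trans (leq_addr _ _); apply: bn; split=> // y Ry.
  by apply: minx; left.
apply: leq_trans (leq_addl _ _); apply: bm; split=> // y Sy.
by apply: minx; right.
Qed.

Lemma essentialP R' R : right_ideal R ->
  essential R' R <-> R' `<=` R /\ forall x, R x -> exists w, R' (x ++ w).
Proof.
move=> idR; split=> -[sub ess]; split=> //.
  move=> x Rx; have [] := ess (ideal_gen [set x]).
  - by move=> _ w [p -> [v _ <-]]; exists x => //; exists (v ++ w); rewrite ?catA.
  - by exists x; exists x => //; exists [::]; rewrite ?cats0.
  - by move=> _ [p -> [v _ <-]]; exact: idR.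
  - by move=> _ [[_ -> [w _ <-]] Rw]; exists w.
move=> I idI [x Ix] IR; have [w Rw] := ess x (IR _ Ix).
by exists (x ++ w); split=> //; exact: idI.
Qed.

Lemma mkseqD (T : Type) (u : nat -> T) m n :
  mkseq u (m + n) = mkseq u m ++ mkseq (fun i => u (m + i)) n.
Proof. by rewrite /mkseq iotaD map_cat add0n -[in iota m n](addn0 m) iotaDl -map_comp. Qed.

(** Padding [x] with the letter [a] gives an end of [R], hence of [R']; a long enough prefix of it
    extends [x] and lies in [R']. *)
Lemma ess_eq_extend (a : A) R' R x : right_ideal R' -> ess_eq R' R ->
  R x -> exists w, R' (x ++ w).
Proof.
move=> idR' E Rx; have : ends R (nth a x) by exists (size x); rewrite mkseq_nth.
rewrite -E => -[n R'n]; exists (mkseq (fun i => nth a x (size x + i)) n).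
rewrite -{1}(mkseq_nth a x) -mkseqD addnC mkseqD; exact: idR'.
Qed.

End RightIdeals.

(** * Growth of images and restriction to words with long images *)

Section RightIdealHomomorphisms.
Variable A : finType.
Implicit Types (phi psi chi alpha : riHom A) (R : set (seq A)).

Lemma DomP phi x : Dom phi x <-> exists y, phi x = Some y.
Proof.
rewrite /Dom /pdom /=; case: (phi x) => [y|]; split=> //; first by exists y.
by case.
Qed.

Lemma riHom_size phi : exists c, forall x y,
  phi x = Some y -> size y <= size x + c.
Proof.
have [n bn] := gen_code_bounded (rifun_fg phi).
(* A word of length at most [n] is encoded as an [n]-tuple of options padded with [None], so the
   maximum runs over a finite list; the default [[::]] only adds harmless zeros. *)
pose s := [seq size (odflt [::] (phi (pmap id (val t)))) |
  t : n.-tuple (option A)].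
exists (\max_(i <- s) i) => x y xy.
have /(gen_code_prefix (@rifun_ideal _ phi)) [p [w [Pp xE]]] : Dom phi x.
  by apply/DomP; exists y.
have /DomP[z pz] := Pp.1.
have : phi x = Some (z ++ w) by rewrite xE (rifun_hom _ pz).
rewrite xy => -[->]; rewrite xE !size_cat addnAC leq_add2r.
apply: leq_trans (leq_addl _ _).
apply: (@leq_bigmax_seq _ s xpredT id) => //.
have sz : size (map Some p ++ nseq (n - size p) None) == n.
  by rewrite size_cat size_map size_nseq subnKC // bn.
apply/mapP; exists (Tuple sz); first by rewrite mem_enum.
rewrite /= pmap_cat map_pK //.
have -> : pmap id (nseq (n - size p) (@None A)) = [::] by elim: (n - _).
by rewrite cats0 pz.
Qed.

(** The bound is on the image rather than on the word, so that membership depends on [phi x] alone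
    and the ideal is saturated for [part phi]. *)
Definition long_dom phi N : set (seq A) :=
  [set x | exists2 y, phi x = Some y & N <= size y].

Lemma long_dom_ideal phi N : right_ideal (long_dom phi N).
Proof.
move=> x w [y xy Ny]; exists (y ++ w); first exact: rifun_hom.
by rewrite size_cat (leq_trans Ny) ?leq_addr.
Qed.

(** A minimal word is a generator of [Dom phi] followed by at most [N] letters, since [N] letters
    already make the image long enough. *)
Lemma long_dom_fg phi N : finitely_generated (long_dom phi N).
Proof.
have [n bn] := gen_code_bounded (rifun_fg phi).
apply: (@fg_prefixes _ _ (n + N) (@long_dom_ideal phi N)) => x [[y xy _] minx].
have /(gen_code_prefix (@rifun_ideal _ phi)) [p [w [Pp xE]]] : Dom phi x.
  by apply/DomP; exists y.
have /DomP[z pz] := Pp.1.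
case: (leqP (size w) N) => [wN|/ltnW Nw]; first by rewrite xE size_cat leq_add ?bn.
rewrite -(minx (p ++ take N w)).
- by rewrite size_cat leq_add ?bn // size_take_min geq_minl.
- exists (z ++ take N w); first exact: rifun_hom.
  by rewrite size_cat size_takel // leq_addl.
- by rewrite xE -{2}(cat_take_drop N w) catA prefix_prefix.
Qed.

Lemma long_dom_ess_eq phi N R : right_ideal R -> long_dom phi N `<=` R ->
  R `<=` Dom phi -> ess_eq R (Dom phi).
Proof.
move=> idR NR sR; apply/seteqP; split=> u [n Rn]; first by exists n; exact: sR.
have /DomP[y xy] := Rn.
exists (n + N); rewrite mkseqD; apply: NR.
exists (y ++ mkseq (fun i => u (n + i)) N); first exact: rifun_hom.
by rewrite size_cat size_mkseq leq_addl.
Qed.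

(** * Restriction of a homomorphism to a subideal *)

Section Restrict.
Variables (phi : riHom A) (R : set (seq A)).
Hypotheses (idR : right_ideal R) (fgR : finitely_generated R).
Hypothesis sR : R `<=` Dom phi.

Definition restrict_fun x := if `[< R x >] then phi x else None.

Lemma restrict_funE x y : restrict_fun x = Some y <-> R x /\ phi x = Some y.
Proof.
rewrite /restrict_fun; case: asboolP => [Rx|nRx]; first by split=> [|[]].
by split=> // -[].
Qed.

Lemma restrict_pdom : pdom restrict_fun = R.
Proof.
apply/seteqP; split=> x; rewrite /pdom /= /restrict_fun; case: asboolP => //.
by move=> Rx _; exact: sR.
Qed.

Lemma restrict_hom x y w :
  restrict_fun x = Some y -> restrict_fun (x ++ w) = Some (y ++ w).
Proof.
move=> /restrict_funE[Rx xy]; apply/restrict_funE.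
by split; [exact: idR|exact: rifun_hom].
Qed.

Lemma restrict_fg : finitely_generated (pdom restrict_fun).
Proof. by rewrite restrict_pdom. Qed.

Definition restrict : riHom A :=
  @RiHom A restrict_fun (pdom_ideal restrict_hom) restrict_hom restrict_fg.

Lemma restrict_ess : (forall x, Dom phi x -> exists w, R (x ++ w)) ->
  ess_restriction restrict phi.
Proof.
move=> ess; split=> [x y /restrict_funE[]//|].
apply/essentialP; first exact: rifun_ideal.
by rewrite /Dom /= restrict_pdom.
Qed.

Lemma part_restrictE x y :
  part restrict x y <-> [/\ R x, R y & phi x = phi y].
Proof.
rewrite /part /Dom /= restrict_pdom /restrict_fun.
by split=> -[Rx Ry]; rewrite (asboolT Rx) (asboolT Ry).
Qed.

Lemma cdom_restrict : cdom (part restrict) = R.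
Proof.
apply/seteqP; split=> x /=; first by move=> /part_restrictE[].
by move=> Rx; apply/part_restrictE.
Qed.

Lemma cong_ess_restrict : ess_eq R (Dom phi) ->
  cong_ess_restriction (part restrict) (part phi).
Proof.
move=> E; have cphi : cdom (part phi) = Dom phi.
  by apply/seteqP; split=> x; [case|].
split; rewrite ?cdom_restrict ?cphi //.
move=> x y Rx Ry; split; first by move=> /part_restrictE[_ _ e]; split=> //; exact: sR.
by move=> [_ _ e]; apply/part_restrictE.
Qed.

Lemma saturated_restrict_pcc : prefix_code (pimage phi (domC phi)) ->
  (forall x y, R x -> phi y = phi x -> R y) ->
  prefix_code_congruence (part restrict).
Proof.
move=> pc sat; apply: part_pcc => x' y'.
move=> [x _ /restrict_funE[Rx xx']] [y [_ miny] /restrict_funE[Ry yy']].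
have Dx := sR Rx; have Dy := sR Ry.
have [p [v [Pp xE]]] := gen_code_prefix (@rifun_ideal _ phi) Dx.
have [q [w [Pq yE]]] := gen_code_prefix (@rifun_ideal _ phi) Dy.
have /DomP[s ps] := Pp.1; have /DomP[t qt] := Pq.1.
move: xx' yy'; rewrite {1}xE {1}yE (rifun_hom _ ps) (rifun_hom _ qt) => -[<-] [<-].
move=> /prefixP[u]; rewrite -catA => uE.
(* The generator images [s] and [t] are prefixes of one word, and they belong to a prefix code. *)
have st : s = t.
  have Is : pimage phi (domC phi) s by exists p.
  have It : pimage phi (domC phi) t by exists q.
  case: (leqP (size s) (size t)) => [le|/ltnW le].
    apply: pc => //; rewrite prefixE; apply/eqP.
    by have := congr1 (take (size s)) uE; rewrite (takel_cat w) // take_size_cat.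
  apply/esym/pc => //; rewrite prefixE; apply/eqP.
  have := congr1 (take (size t)) uE.
  by rewrite (take_size_cat w) // (takel_cat (v ++ u)).
move: uE; rewrite -st => /eqP; rewrite eqseq_cat // eqxx => /eqP wE.
suff u0 : u = [::] by rewrite wE u0 cats0.
(* [q ++ v] has the same image as [x], so saturation puts it in [R]; as a prefix of the minimal word
   [y] it must be [y]. *)
suff /(congr1 size) : q ++ v = y.
  rewrite yE wE !size_cat addnA -[LHS]addn0 => /addnI/esym.
  exact: size0nil.
apply: miny; last by rewrite yE wE catA prefix_prefix.
rewrite /Dom /= restrict_pdom; apply: (sat x) => //.
by rewrite xE (rifun_hom _ ps) (rifun_hom _ qt) st.
Qed.

End Restrict.

(** * Essential restrictions, maximal extensions and composition *)

Lemma ess_restriction_refl phi : ess_restriction phi phi.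
Proof.
split=> //; apply/essentialP; first exact: rifun_ideal.
by split=> // x Dx; exists [::]; rewrite cats0.
Qed.

Lemma ess_restrictionP phi psi : ess_restriction phi psi <->
  restriction phi psi /\ forall x, Dom psi x -> exists w, Dom phi (x ++ w).
Proof.
split=> -[res ess]; split=> //.
  by case/(essentialP _ (@rifun_ideal _ psi)): ess.
apply/essentialP; first exact: rifun_ideal.
split=> // x /DomP[y /res xy]; by apply/DomP; exists y.
Qed.

Lemma ess_restriction_trans psi phi chi :
  ess_restriction phi psi -> ess_restriction psi chi -> ess_restriction phi chi.
Proof.
move=> /ess_restrictionP[r1 e1] /ess_restrictionP[r2 e2].
apply/ess_restrictionP; split=> [x y /r1/r2//|x /e2[w /e1[v Dv]]].
by exists (w ++ v); rewrite catA.
Qed.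

Lemma max_ext_ess phi : ess_restriction phi (max_ext phi).
Proof. by case: ((max_extP phi (max_ext phi)).2 erefl). Qed.

Lemma ess_restriction_max phi psi :
  ess_restriction phi psi -> max_ext phi = max_ext psi.
Proof.
move=> e; have [em mm] := (max_extP psi (max_ext psi)).2 erefl.
apply/max_extP; split; first exact: ess_restriction_trans e em.
move=> Psi /ess_restrictionP[_ ess] mPsi; apply: mm => //.
apply/ess_restrictionP; split=> [x y /em.1/mPsi//|x /ess[w /DomP[y]]].
by move=> /e.1 xy; exists w; apply/DomP; exists y.
Qed.

(** Two successive extensions of [x] are made: the first reaches [Dom phi], the second brings the
    image into [Dom alpha]. *)
Lemma comp_ess alpha alpha' phi phi' :
  ess_restriction alpha alpha' -> ess_restriction phi phi' ->
  ess_restriction (Defs.comp alpha phi) (Defs.comp alpha' phi').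
Proof.
move=> /ess_restrictionP[ra ea] /ess_restrictionP[rp ep].
apply/ess_restrictionP; split=> [x y /=|x /DomP[z /=]].
  by case E: (phi x) => [u|//] /= /ra; rewrite (rp _ _ E).
case E: (phi' x) => [u|//] /= uz.
have /ep[w /DomP[v xv]] : Dom phi' x by apply/DomP; exists u.
have := rp _ _ xv; rewrite (rifun_hom _ E) => -[vE].
have /ea[t /DomP[s st]] : Dom alpha' v.
  by apply/DomP; exists (z ++ w); rewrite -vE; exact: rifun_hom.
exists (w ++ t); apply/DomP; exists s.
by rewrite /= catA (rifun_hom _ xv) /= st.
Qed.

Lemma th_val_inj (f g : thompson_higman A) : th_val f = th_val g -> f = g.
Proof.
case: f => f pf; case: g => g pg /= e; subst g.
by congr ThompsonHigman; exact: Prop_irrelevance.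
Qed.

(* Words of [Dom chi] with a long image are themselves long, hence lie in the
   finitely generated essential subideal [Dom phi]. *)
Lemma ess_restriction_long phi chi : ess_restriction phi chi ->
  exists M, forall x y, chi x = Some y -> M <= size y -> phi x = Some y.
Proof.
move=> /ess_restrictionP[res ess].
have [n long] := fg_long_prefix (@rifun_ideal _ phi) (rifun_fg phi).
have [c bc] := riHom_size chi; exists (n + c) => x y xy ny.
have /ess[w Dw] : Dom chi x by apply/DomP; exists y.
have nx : n <= size x by rewrite -(leq_add2r c) (leq_trans ny) ?bc.
have /DomP[z xz] : Dom phi x by exact: long Dw.
by rewrite xz -xy (res _ _ xz).
Qed.

End RightIdealHomomorphisms.

Lemma le_end_of_factor (A : finType) (alpha phi psi h : riHom A) :
  prefix_code (pimage phi (domC phi)) -> prefix_code (pimage psi (domC psi)) ->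
  ess_restriction psi h -> ess_restriction (Defs.comp alpha phi) h ->
  le_end (part psi) (part phi).
Proof.
move=> pphi ppsi epsi echi.
have [M1 long1] := ess_restriction_long epsi.
have [M2 long2] := ess_restriction_long echi.
(* This threshold is at least [M1] and [M2], so words of [R2] can be transferred through [h] between
   [psi] and [comp alpha phi] in both directions. *)
pose R2 := long_dom psi (M1 + M2).
have R2chi x y : psi x = Some y -> M1 + M2 <= size y ->
    Defs.comp alpha phi x = Some y.
  move=> xy My; apply: long2; first exact: epsi.1.
  by rewrite (leq_trans _ My) ?leq_addl.
have sR2 : R2 `<=` Dom psi by move=> x [y xy _]; apply/DomP; exists y.
have sR2phi : R2 `<=` Dom phi.
  move=> x [y xy My]; have := R2chi _ _ xy My; rewrite /= => E.
  by apply/DomP; case: (phi x) E => // u _; exists u.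
have sat x z : R2 x -> phi z = phi x -> psi z = psi x /\ R2 z.
  move=> [y xy My] zx.
  have zy : psi z = Some y.
    apply: long1; last by rewrite (leq_trans _ My) ?leq_addr.
    by apply: echi.1; rewrite /= zx; exact: R2chi.
  by split; [rewrite zy|exists y].
have idR2 : right_ideal R2 by exact: long_dom_ideal.
have fgR2 : finitely_generated R2 by exact: long_dom_fg.
have [n2 bn2] := gen_code_bounded fgR2.
have [c bc] := riHom_size phi.
(* A generator of [R2] has length at most [n2], so its image under [phi] is shorter than [N], and
   none of its prefixes lies in [long_dom phi N]. *)
pose N := (n2 + c).+1.
pose R1 := R2 `|` long_dom phi N.
have sR1 : R1 `<=` Dom phi.
  by move=> x [/sR2phi//|[y xy _]]; apply/DomP; exists y.
have idR1 : right_ideal R1.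
  by move=> x w [/idR2 h2|/long_dom_ideal h1]; [left|right].
have fgR1 : finitely_generated R1.
  by apply: fgU => //; [exact: long_dom_ideal|exact: long_dom_fg].
have cd1 := cdom_restrict idR1 fgR1 sR1.
have cd2 := cdom_restrict idR2 fgR2 sR2.
exists (part (restrict idR1 fgR1 sR1)), (part (restrict idR2 fgR2 sR2)); split.
- split; last first.
    by apply/cong_ess_restrict/(@long_dom_ess_eq _ _ N) => // x; right.
  apply: saturated_restrict_pcc => // x y [R2x|[z xz Nz]] e.
    by left; case: (sat _ _ R2x e).
  by right; exists z => //; rewrite e.
- split; last by apply/cong_ess_restrict/(@long_dom_ess_eq _ _ (M1 + M2)).
  by apply: saturated_restrict_pcc => // x y [z xz Nz] e; exists z; rewrite ?e.
- rewrite /cdomC cd1 cd2 => x Px; have [R2x minx] := Px; split; first by left.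
  move=> y [R2y|[z yz Nz]] yx; first exact: minx.
  move: yx => /prefixP[v xE].
  have := bc x (z ++ v); rewrite {1}xE (rifun_hom _ yz) => /(_ erefl).
  rewrite size_cat leqNgt => /negP[]; apply: leq_trans (leq_addr _ _).
  by apply: leq_trans Nz; rewrite ltnS leq_add2r bn2.
- move=> C [x + CE]; rewrite cd2 => R2x.
  (* The family consists of all classes inside [C]; by [sat], the class of each element of [C] is
     one of them. *)
  exists [set D | is_class (part (restrict idR1 fgR1 sR1)) D /\ D `<=` C].
    by move=> D [].
  apply/seteqP; split=> [y Cy|y [D [_ DC]] /DC//].
  move: (Cy); rewrite CE => /part_restrictE[_ R2y xy].
  exists [set z | part (restrict idR1 fgR1 sR1) y z]; last first.
    by apply/part_restrictE; split=> //; left.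
  split; first by exists y => //; rewrite cd1; left.
  move=> z /part_restrictE[_ _ yz]; apply/part_restrictE.
  by have [zy R2z] := sat y z R2y (esym yz); rewrite xy zy.
Qed.

(** The common restriction [chi] is [psi] on the domain of the restricted congruence [sim2]; having
    it is enough for [psi] and [comp alpha phi] to have the same maximal extension. *)
Lemma factor_of_le_end (A : finType) (a : A) (phi psi : riHom A) :
  le_end (part psi) (part phi) ->
  exists alpha chi : riHom A,
    ess_restriction chi psi /\ ess_restriction chi (Defs.comp alpha phi).
Proof.
have cpart (chi : riHom A) : cdom (part chi) = Dom chi.
  by apply/seteqP; split=> x; [case|].
move=> [sim1 [sim2 [[pcc1 [ends1 sub1 res1]] [pcc2 [ends2 sub2 res2]] _ cls]]].
rewrite !cpart in ends1 sub1 ends2 sub2.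
have [[sym1 trans1 mul1] _] := pcc1.
have [[sym2 trans2 mul2] [P2 [finP2 _ DE2 _]]] := pcc2.
have id1 : right_ideal (cdom sim1) by move=> x w; exact: mul1.
have id2 : right_ideal (cdom sim2) by move=> x w; exact: mul2.
have fg2 : finitely_generated (cdom sim2) by exists P2.
have coarse x y : cdom sim2 x -> sim1 x y -> sim2 x y.
  move=> Dx xy; have [F FC E] := cls _ (ex_intro2 _ _ x Dx erefl).
  have : [set y | sim2 x y] x by [].
  rewrite E => -[D FD Dx']; suff : [set y | sim2 x y] y by [].
  rewrite E; exists D => //; have [z _ DE] := FC _ FD.
  by move: Dx'; rewrite DE /= => zx; exact: trans1 zx xy.
have sub21 : cdom sim2 `<=` cdom sim1.
  move=> x Dx; have [F FC E] := cls _ (ex_intro2 _ _ x Dx erefl).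
  have : [set y | sim2 x y] x by [].
  rewrite E => -[D FD]; have [z _ ->] := FC _ FD => /= zx.
  exact: trans1 (sym1 _ _ zx) zx.
have phi_psi x y : cdom sim2 x -> cdom sim2 y -> phi x = phi y -> psi x = psi y.
  move=> Dx Dy e; have : sim1 x y.
    apply/res1; [exact: sub21|exact: sub21|].
    by split=> //; apply/sub1/sub21.
  by move=> /(coarse _ _ Dx) /(res2 _ _ Dx Dy)[].
(* [S] is the graph of the future [alpha], single-valued by [phi_psi]; classical choice turns it
   into the partial function [F]. *)
pose S y z := exists x, [/\ cdom sim2 x, phi x = Some y & psi x = Some z].
pose F y := if pselect (exists z, S y z) is left e
            then Some (projT1 (cid e)) else None.
have FP y z : F y = Some z <-> S y z.
  rewrite /F; case: pselect => [e|ne]; last by split=> // s; case: ne; exists z.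
  case: cid => t /= St; split=> [[<-//]|Sz]; congr Some.
  case: St Sz => [x [Dx xy xt]] [x' [Dx' xy' xz]].
  by have := phi_psi _ _ Dx Dx' (etrans xy (esym xy')); rewrite xt xz => -[].
have Fh y z w : F y = Some z -> F (y ++ w) = Some (z ++ w).
  move=> /FP[x [Dx xy xz]]; apply/FP; exists (x ++ w).
  by split; [exact: id2|exact: rifun_hom|exact: rifun_hom].
have Ffg : finitely_generated (pdom F).
  exists (pimage phi P2).
    apply: (@sub_finite_set _ _ ((fun x => odflt [::] (phi x)) @` P2)).
      by move=> y [x Px xy]; exists x => //; rewrite xy.
    exact: finite_image.
  have P2D p : P2 p -> cdom sim2 p.
    by move=> Pp; rewrite DE2; exists p => //; exists [::]; rewrite ?cats0.
  apply/seteqP; split=> [y|_ [y [p Pp py] [w _ <-]]].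
    rewrite /pdom /=; case E: (F y) => [z|//] _.
    have /FP[x [+ xy _]] := E; rewrite DE2 => -[p Pp [w _ xE]].
    have /P2D/sub21/sub1/DomP[u pu] := Pp.
    exists u; first by exists p.
    by exists w => //; move: xy; rewrite -xE (rifun_hom _ pu) => -[].
  apply: (pdom_ideal Fh); rewrite /pdom /=.
  have /P2D/sub2/DomP[z pz] := Pp.
  suff -> : F y = Some z by [].
  by apply/FP; exists p; split=> //; exact: P2D.
pose alpha := RiHom (pdom_ideal Fh) Fh Ffg.
exists alpha, (restrict id2 fg2 sub2); split.
  by apply: restrict_ess => x; exact: ess_eq_extend.
apply/ess_restrictionP; split=> [x z /restrict_funE[Dx xz]|x /DomP[z]] /=.
  have /sub21/sub1/DomP[y xy] := Dx.
  by rewrite xy /=; apply/FP; exists x.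
(* Here [x] shares its image with some [t] in the domain of [sim2]. Once [x ++ w] is in the domain
   of [sim1], it is [sim1]-equivalent to [t ++ w], and [coarse] puts it in the domain of [sim2]. *)
case E: (phi x) => [y|//] /= /FP[t [Dt ty _]].
have /(ess_eq_extend a id1 ends1)[w Dw] : Dom phi x by apply/DomP; exists y.
exists w; rewrite /Dom /= restrict_pdom //.
have Dtw : cdom sim2 (t ++ w) by exact: id2.
have : sim2 (t ++ w) (x ++ w).
  apply: coarse => //; apply/res1 => //; first exact: sub21.
  split; [by apply/sub1/sub21|exact: sub1|].
  by rewrite (rifun_hom _ ty) (rifun_hom _ E).
move=> h; exact: trans2 (sym2 _ _ h) h.
Qed.

Theorem theorem3p32 (k : nat) (hk : 2 <= k) (A : finType) (hA : #|A| = k)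
  (f g : thompson_higman A) (phi psi : riHom A)
  (hphi : represents phi f) (hpsi : represents psi g)
  (pphi : prefix_code (pimage phi (domC phi)))
  (ppsi : prefix_code (pimage psi (domC psi))) :
  le_L g f <-> le_end (part psi) (part phi).
Proof.
rewrite /represents in hphi hpsi; split=> [[alpha E]|].
  (* [max_ext psi] serves as common extension: it is also the maximal extension of
     [comp alpha (max_ext phi)], which essentially extends [comp alpha phi]. *)
  apply: (@le_end_of_factor _ alpha _ _ (max_ext psi)) => //.
    exact: max_ext_ess.
  have -> : max_ext psi = max_ext (Defs.comp alpha (max_ext phi)).
    by rewrite -hpsi E -hphi.
  apply: ess_restriction_trans (max_ext_ess _).
  by apply: comp_ess; [exact: ess_restriction_refl|exact: max_ext_ess].
have /card_gt0P[a _] : 0 < #|A| by rewrite hA (leq_trans _ hk).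
move=> /(factor_of_le_end a)[alpha [chi [chi1 chi2]]].
exists (th_class alpha); apply: th_val_inj; rewrite /= hphi hpsi.
rewrite -(ess_restriction_max chi1) (ess_restriction_max chi2).
by apply/ess_restriction_max/comp_ess; exact: max_ext_ess.
Qed.
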